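(* Let $\mathcal F:\mathcal P_2(\mathbb R^d)\to(-\infty,\infty]$ be proper, lower semicontinuous and geodesically convex. Let $(\mu_t)_{t\ge0}$ be the forward Euler iterates with constant step size $\eta_t=\eta>0$ for all $t\ge0$, with $\xi_t=\nabla_{W_2}\mathcal F(\mu_t)$, and let $\bar\mu_T$ ($T\ge1$) be the average iterate defined by $\bar\mu_1=\mu_0$ and $\bar\mu_{t+1}=\big[(1-\tfrac1{t+1})\,\mathrm{id}+\tfrac1{t+1}\,\boldsymbol t_{\bar\mu_t}^{\mu_t}\big]_\#\bar\mu_t$ for $t\ge1$. Then, for all $\pi\in\mathcal P_2(\mathbb R^d)$, the upper bound $$\mathcal F(\bar\mu_T)-\mathcal F(\pi)\le\frac1T\left[\frac{W_2^2(\mu_0,\pi)}{2\eta}+\frac\eta2\sum_{t=0}^{T-1}\int_{\mathbb R^d}\|\xi_t(x)\|^2\,\mathrm d\mu_t(x)\right]$$ is minimized over $\eta>0$ (with $\sum_{t=0}^{T-1}\int\|\xi_t\|^2\,\mathrm d\mu_t$ regarded as fixed) when $$\eta=\frac{W_2(\mu_0,\pi)}{\sqrt{\sum_{t=0}^{T-1}\int_{\mathbb R^d}\|\xi_t(x)\|^2\,\mathrm d\mu_t(x)}}.$$ Moreover, if $\eta$ satisfies this identity, then $$\mathcal F(\bar\mu_T)-\mathcal F(\pi)\le\frac1T\,W_2(\mu_0,\pi)\sqrt{\sum_{t=0}^{T-1}\int_{\mathbb R^d}\|\xi_t(x)\|^2\,\mathrm d\mu_t(x)}.$$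
   Context: $\mathcal P_2(\mathbb R^d)$: Borel probability measures on $\mathbb R^d$ with finite second moment; $W_2$: quadratic Wasserstein distance; $T_\#\mu$: pushforward; $\boldsymbol t_\mu^\nu$: optimal transport map from $\mu$ to $\nu$ (whenever written, it is assumed to exist; the paper restricts the domain $\{\mathcal F<\infty\}$ to absolutely continuous measures for this purpose). Proper: $\mathcal F(\mu)<\infty$ for some $\mu$. Geodesically convex: for all $\mu,\nu$ there is a constant speed $W_2$-geodesic $(\lambda_s)_{s\in[0,1]}$ from $\mu$ to $\nu$ with $\mathcal F(\lambda_s)\le(1-s)\mathcal F(\mu)+s\mathcal F(\nu)$ for all $s\in[0,1]$. Wasserstein gradient: $\xi\in L^2(\mu)$ belongs to the Fréchet subdifferential $\partial\mathcal F(\mu)$ if $\mathcal F(\nu)-\mathcal F(\mu)\ge\int\langle\xi(x),\boldsymbol t_\mu^\nu(x)-x\rangle\,\mathrm d\mu(x)+o(W_2(\mu,\nu))$ for all $\nu$ with $\mathcal F(\nu)<\infty$; for geodesically convex $\mathcal F$ this is equivalent to the same inequality without the $o(\cdot)$ term. $\nabla_{W_2}\mathcal F(\mu)$ is the element of $\partial\mathcal F(\mu)$ of minimal $L^2(\mu)$ norm (assumed to exist along the iterates). In the paper, $\mathcal F(\mu)=\int V\,\mathrm d\mu+\frac12\iint W(x-y)\,\mathrm d\mu(x)\mathrm d\mu(y)+\int H(\mu(x))\,\mathrm dx$ is a sum of potential, interaction and internal energies. Forward Euler iterates: given $\mu_0\in\mathcal P_2(\mathbb R^d)$ and step sizes $\eta_t>0$,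 $\mu_{t+1}=(\mathrm{id}-\eta_t\xi_t)_\#\mu_t$ with $\xi_t=\nabla_{W_2}\mathcal F(\mu_t)$, $t\ge0$. The $\mu_t$ ($t\ge1$) depend on $\eta$. *)

(* Defs.v *)
From HB Require Import structures.
From mathcomp Require Import all_boot all_order all_algebra.
From mathcomp Require Import all_classical all_reals all_analysis.
Import Order.TTheory GRing.Theory Num.Theory.
Import numFieldNormedType.Exports.

Set Implicit Arguments.
Unset Strict Implicit.
Unset Printing Implicit Defensive.

Local Open Scope classical_set_scope.
Local Open Scope ring_scope.

Definition borel_rV_display : measure_display. Proof. by constructor. Qed.

Section borel_rV.
Variables (R : realType) (d : nat).

Definition borel_rV : set (set 'rV[R]_d) := <<s [set A | open A] >>.

Let borel_rV0 : borel_rV set0.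
Proof. exact: sigma_algebra0. Qed.

Let borel_rVC A : borel_rV A -> borel_rV (~` A).
Proof. exact: sigma_algebraC. Qed.

Let borel_rV_bigcup (A : (set 'rV[R]_d)^nat) :
  (forall i, borel_rV (A i)) -> borel_rV (\bigcup_i A i).
Proof. exact: sigma_algebra_bigcup. Qed.

HB.instance Definition _ := @isMeasurable.Build borel_rV_display 'rV[R]_d
  borel_rV borel_rV0 borel_rVC borel_rV_bigcup.

End borel_rV.

(* The library's norm on row vectors is the sup norm, so the Euclidean
   structure of R^d is introduced here. *)
Definition dotrV (R : realType) (d : nat) (x y : 'rV[R]_d) : R :=
  \sum_(i < d) x ord0 i * y ord0 i.

Definition sqnorm (R : realType) (d : nat) (x : 'rV[R]_d) : R := dotrV x x.

(* Only the values on Borel sets matter: the library's measures also take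
   (unconstrained) values on non-measurable sets.  Hence pushforwards and
   marginals below are compared on measurable sets only. *)
Record P2 (R : realType) (d : nat) := MkP2 {
  P2_prob :> probability 'rV[R]_d R ;
  P2_moment : (\int[P2_prob]_x (sqnorm x)%:E < +oo)%E }.

Definition is_pushforward d1 d2 (X : measurableType d1) (Y : measurableType d2)
    (R : realType) (f : X -> Y) (mu : probability X R) (nu : probability Y R) :=
  measurable_fun setT f /\
  forall A, measurable A -> nu A = pushforward mu f A.

Section wasserstein.
Variables (R : realType) (d : nat).
Local Notation E := 'rV[R]_d.
Implicit Types (mu nu : P2 R d) (gamma : probability (E * E)%type R).

Definition is_coupling mu nu gamma :=
  is_pushforward fst gamma mu /\ is_pushforward snd gamma nu.

Definition transport_cost gamma : \bar R :=
  (\int[gamma]_z (sqnorm (z.1 - z.2))%:E)%E.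

(* The infimum is finite on P2, so [fine] loses nothing. *)
Definition W2 mu nu : R :=
  Num.sqrt (fine (ereal_inf (transport_cost @` is_coupling mu nu))).

Definition is_otmap mu nu (T : E -> E) :=
  is_pushforward T mu nu /\
  (\int[mu]_x (sqnorm (T x - x))%:E = (W2 mu nu ^+ 2)%:E)%E.

(* "The optimal transport map from mu to nu exists", uniqueness being
   understood mu-almost everywhere. *)
Definition has_otmap mu nu :=
  exists T, is_otmap mu nu T /\
    forall T', is_otmap mu nu T' -> {ae mu, forall x, T' x = T x}.

Definition otmap mu nu : E -> E := xget (id : E -> E) [set T | is_otmap mu nu T].

Definition is_geodesic mu nu (lam : R -> P2 R d) :=
  [/\ lam 0 = mu, lam 1 = nu &
    forall s r, 0 <= s <= 1 -> 0 <= r <= 1 ->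
      W2 (lam s) (lam r) = `|s - r| * W2 mu nu].

Definition lebesgue_null (N : set E) :=
  forall eps : R, 0 < eps -> exists a b : nat -> E,
    [/\ forall k i, a k ord0 i <= b k ord0 i,
        N `<=` \bigcup_k
          [set x | forall i, a k ord0 i <= x ord0 i <= b k ord0 i] &
        (\sum_(0 <= k <oo) (\prod_(i < d) (b k ord0 i - a k ord0 i))%:E
           <= eps%:E)%E].

Definition absolutely_continuous mu :=
  forall N, measurable N -> lebesgue_null N -> mu N = 0%E.

End wasserstein.

Section functionals.
Variables (R : realType) (d : nat) (F : P2 R d -> \bar R).
Local Notation E := 'rV[R]_d.
Implicit Types (mu nu : P2 R d) (xi : E -> E).

Definition proper_functional := exists mu, (F mu < +oo)%E.

(* Lower semicontinuity for the metric W2.  It forces F to take the same value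
   on elements of P2 which agree on Borel sets. *)
Definition lsc_functional :=
  forall mu (c : \bar R), (c < F mu)%E ->
    exists2 delta : R, 0 < delta &
      forall nu, W2 mu nu < delta -> (c < F nu)%E.

Definition geodesically_convex :=
  forall mu nu, exists2 lam, is_geodesic mu nu lam &
    forall s : R, 0 <= s <= 1 ->
      (F (lam s) <= (1 - s)%:E * F mu + s%:E * F nu)%E.

Definition in_L2 mu xi :=
  measurable_fun setT xi /\ (\int[mu]_x (sqnorm (xi x))%:E < +oo)%E.

(* Finiteness of F mu is implicit in the usual definition, where F mu is
   subtracted. *)
Definition in_subdifferential mu xi :=
  [/\ (F mu < +oo)%E, in_L2 mu xi &
    forall eps : R, 0 < eps -> exists2 delta : R, 0 < delta &
      forall nu, (F nu < +oo)%E -> W2 mu nu < delta ->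
        (((\int[mu]_x dotrV (xi x) (otmap mu nu x - x)) - eps * W2 mu nu)%R%:E
           <= F nu - F mu)%E].

Definition is_wasserstein_gradient mu xi :=
  in_subdifferential mu xi /\
  forall zeta, in_subdifferential mu zeta ->
    (\int[mu]_x (sqnorm (xi x))%:E <= \int[mu]_x (sqnorm (zeta x))%:E)%E.

Definition forward_euler (eta : nat -> R) (mu : nat -> P2 R d)
    (xi : nat -> E -> E) :=
  forall t, is_wasserstein_gradient (mu t) (xi t) /\
    is_pushforward (fun x : E => x - eta t *: xi t x) (mu t) (mu t.+1).

End functionals.

(* The entry of index 0 of [mubar] is not constrained. *)
Definition average_iterates (R : realType) (d : nat) (mu mubar : nat -> P2 R d) :=
  mubar 1%N = mu 0%N /\
  forall t, (1 <= t)%N ->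
    is_pushforward
      (fun x : 'rV[R]_d => (1 - t.+1%:R^-1) *: x
                           + t.+1%:R^-1 *: otmap (mubar t) (mu t) x)
      (mubar t) (mubar t.+1).

Definition euler_bound (R : realType) (T : nat) (w S eta : R) : R :=
  T%:R^-1 * (w ^+ 2 / (2 * eta) + eta / 2 * S).

(* Main.v *)
(* The geodesics supplied by convexity are displacement interpolations: if t_s
   is optimal from mu to the point at time s and r_s from there to nu, then
   r_s o t_s transports mu to nu at cost W2(mu, nu)^2, so it is the optimal map
   t, and the equality case of the quadratic inequality behind this forces
   t_s - id = s (t - id) almost everywhere.  Hence the subdifferential inequality
   holds without remainder and F is convex along the averaging step.  Comparing
   mu_(t+1) with nu through the coupling (id - eta xi_t, t_(mu_t)^nu) of mu_t
   gives
     W2(mu_(t+1), nu)^2 <= W2(mu_t, nu)^2 + 2 eta (F nu - F mu_t)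
                           + eta^2 |xi_t|^2,
   which telescopes. *)
Require Import Defs.
From HB Require Import structures.
From mathcomp Require Import all_boot all_order all_algebra.
From mathcomp Require Import all_classical all_reals all_analysis.
From mathcomp Require Import measurable_realfun ring lra.
Import Order.TTheory GRing.Theory Num.Theory.
Import numFieldNormedType.Exports.

Set Implicit Arguments.
Unset Strict Implicit.

Local Open Scope classical_set_scope.
Local Open Scope ring_scope.

(** * Measurability and integrability of Euclidean expressions *)

Section euclidean_measurability.
Variables (R : realType) (d : nat).
Local Notation E := 'rV[R]_d.

Lemma measurable_coord (i : 'I_d) :
  measurable_fun setT (fun x : E => x ord0 i).
Proof.
apply: (measurability _ (RGenOpens.measurableE R)).
move=> _ [_ [a [b ->]] <-]; rewrite setTI; apply: sub_sigma_algebra => /=.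
by apply: open_comp => [x _|]; [exact: coord_continuous|exact: interval_open].
Qed.

Lemma sqnorm_ge0 (x : E) : 0 <= sqnorm x.
Proof. by apply: sumr_ge0 => i _; rewrite -expr2 sqr_ge0. Qed.

Lemma sqnorm_eq0 (x : E) : sqnorm x = 0 -> x = 0.
Proof.
move=> /eqP; rewrite psumr_eq0 => [/allP x0|i _]; last by rewrite -expr2 sqr_ge0.
apply/rowP => i; rewrite mxE; apply/eqP.
by have := x0 i (mem_index_enum i); rewrite /= mulf_eq0 orbb.
Qed.

Lemma sqnorm0 : sqnorm (0 : E) = 0.
Proof. by apply: big1 => i _; rewrite mxE mul0r. Qed.

Context {dX : measure_display} {X : measurableType dX}.
Implicit Types a b : X -> E.

(** Working coordinate by coordinate reduces differences and scalings to scalar functions; this is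
    enough because [dotrV] and [sqnorm] read only coordinates. *)
Definition coord_measurable a :=
  forall i, measurable_fun setT (fun x => a x ord0 i).

Lemma coord_measurable_fun a : measurable_fun setT a -> coord_measurable a.
Proof. move=> ma i; exact: (measurableT_comp (measurable_coord i) ma). Qed.

Lemma coord_measurableZ (k : R) a : coord_measurable a ->
  coord_measurable (fun x => k *: a x).
Proof.
move=> ma i; under eq_fun do rewrite mxE.
exact: measurable_funM.
Qed.

Lemma coord_measurableB a b : coord_measurable a -> coord_measurable b ->
  coord_measurable (fun x => a x - b x).
Proof.
move=> ma mb i; under eq_fun do rewrite !mxE.
exact: measurable_funB.
Qed.

Lemma measurable_dotrV a b : coord_measurable a -> coord_measurable b ->
  measurable_fun setT (fun x => dotrV (a x) (b x)).
Proof. by move=> ma mb; apply: measurable_sum => i; exact: measurable_funM. Qed.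

Lemma measurable_sqnorm a : coord_measurable a ->
  measurable_fun setT (fun x => sqnorm (a x)).
Proof. by move=> ma; exact: measurable_dotrV. Qed.

(** In each coordinate [|a_i b_i| <= a_i^2 + b_i^2], so the inner product is dominated by the sum of
    the two squared norms. *)
Lemma integrable_dotrV (mu : probability X R) a b :
  coord_measurable a -> coord_measurable b ->
  mu.-integrable setT (EFin \o (fun x => sqnorm (a x))) ->
  mu.-integrable setT (EFin \o (fun x => sqnorm (b x))) ->
  mu.-integrable setT (EFin \o (fun x => dotrV (a x) (b x))).
Proof.
move=> ma mb ia ib.
apply: (le_integrable _ _ _ (integrableD _ ia ib)) => //.
  by apply/measurable_EFinP; exact: measurable_dotrV.
move=> x _ /=; rewrite lee_fin (ger0_norm (addr_ge0 _ _)) ?sqnorm_ge0//.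
rewrite /dotrV /sqnorm /dotrV -big_split/=.
apply: le_trans (ler_norm_sum _ _ _) _; apply: ler_sum => i _.
rewrite normrM -[X in _ <= X + _]ger0_norm -?expr2 ?sqr_ge0//.
rewrite normrX -[X in _ <= _ + X]ger0_norm ?sqr_ge0// normrX.
have := sqr_ge0 (`|a x ord0 i| - `|b x ord0 i|).
have := normr_ge0 (a x ord0 i); have := normr_ge0 (b x ord0 i); nra.
Qed.

Lemma integrable_sqnorm (mu : probability X R) a : coord_measurable a ->
  (\int[mu]_x (sqnorm (a x))%:E < +oo)%E ->
  mu.-integrable setT (EFin \o (fun x => sqnorm (a x))).
Proof.
move=> ma ia; apply/integrableP; split.
  by apply/measurable_EFinP; exact: measurable_sqnorm.
by under eq_integral do rewrite /= ger0_norm ?sqnorm_ge0//.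
Qed.

End euclidean_measurability.

(** * Composition and change of variables for pushforwards *)

Section pushforwards.
Variable R : realType.

Lemma is_pushforward_comp d1 d2 d3 (X : measurableType d1)
    (Y : measurableType d2) (Z : measurableType d3) (f : X -> Y) (g : Y -> Z)
    (mu : probability X R) (nu : probability Y R) (pi : probability Z R) :
  is_pushforward f mu nu -> is_pushforward g nu pi ->
  is_pushforward (g \o f) mu pi.
Proof.
move=> [mf nuE] [mg piE]; split; first exact: measurableT_comp.
move=> A mA; rewrite piE// /pushforward nuE// -[X in measurable X]setTI.
exact: mg.
Qed.

Lemma integral_is_pushforward d1 d2 (X : measurableType d1)
    (Y : measurableType d2) (f : X -> Y)
    (mu : probability X R) (nu : probability Y R) (h : Y -> R) :
  is_pushforward f mu nu -> measurable_fun setT h -> (forall y, 0 <= h y) ->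
  (\int[nu]_y (h y)%:E = \int[mu]_x (h (f x))%:E)%E.
Proof.
move=> [mf nuE] mh h0.
pose phi : {mfun X >-> Y} := HB.pack f (isMeasurableFun.Build _ _ _ _ _ mf).
(* [nu] and the law of [phi] are known to agree on measurable sets only, which is all that the
   integral sees. *)
rewrite (eq_measure_integral (distribution mu phi)); last first.
  by move=> A mA _; exact: nuE.
rewrite ge0_integral_distribution//=.
exact/measurable_EFinP.
Qed.

End pushforwards.

(** * Upper bounds on the Wasserstein distance *)

Section transport.
Variables (R : realType) (d : nat).
Local Notation E := 'rV[R]_d.
Implicit Types mu nu kap : P2 R d.

Lemma W2_ge0 mu nu : 0 <= W2 mu nu.
Proof. exact: sqrtr_ge0. Qed.

Lemma transport_cost_ge0 (gamma : probability (E * E)%type R) :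
  (0 <= transport_cost gamma)%E.
Proof. by apply: integral_ge0 => z _; rewrite lee_fin sqnorm_ge0. Qed.

Lemma W2_le_cost mu nu (gamma : probability (E * E)%type R) :
  is_coupling mu nu gamma ->
  ((W2 mu nu ^+ 2)%:E <= transport_cost gamma)%E.
Proof.
move=> cg; rewrite /W2.
set I := ereal_inf _.
have I0 : (0 <= I)%E.
  by apply: le_ereal_inf_tmp => _ [g _ <-]; exact: transport_cost_ge0.
have Ig : (I <= transport_cost gamma)%E by apply: ereal_inf_lbound; exists gamma.
(* Were [I] infinite, [fine] would return 0 and nonnegativity of the cost would give the bound. *)
rewrite sqr_sqrtr ?fine_ge0//; case: (I) I0 Ig => //= _ _; exact: transport_cost_ge0.
Qed.

(** The joint law of [f] and [g] under [P] is a coupling whose cost is the integral on the right.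
    Every upper bound on [W2] below is obtained by choosing [P], [f] and [g]. *)
Lemma W2_le_common_source dX (X : measurableType dX) (P : probability X R)
    (f g : X -> E) mu nu :
  is_pushforward f P mu -> is_pushforward g P nu ->
  ((W2 mu nu ^+ 2)%:E <= \int[P]_x (sqnorm (f x - g x))%:E)%E.
Proof.
move=> [mf muE] [mg nuE].
have mfg := measurable_fun_pair mf mg.
pose phi : {mfun X >-> (E * E)%type} :=
  HB.pack (fun x => (f x, g x)) (isMeasurableFun.Build _ _ _ _ _ mfg).
have phiP : is_pushforward phi P (distribution P phi) by split.
have -> : (\int[P]_x (sqnorm (f x - g x))%:E =
    transport_cost (distribution P phi))%E.
  rewrite /transport_cost (integral_is_pushforward phiP) //=.
    apply: measurable_sqnorm; apply: coord_measurableB;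
      apply: coord_measurable_fun; [exact: measurable_fst|exact: measurable_snd].
  by move=> z; exact: sqnorm_ge0.
apply: W2_le_cost; split; split.
- exact: measurable_fst.
- by move=> A mA; rewrite muE.
- exact: measurable_snd.
- by move=> A mA; rewrite nuE.
Qed.

End transport.

(** * Rigidity of displacement interpolation *)

Section displacement.
Variables (R : realType) (d : nat).
Local Notation E := 'rV[R]_d.
Implicit Types mu nu kap : P2 R d.

Lemma sqnormBC (x y : E) : sqnorm (x - y) = sqnorm (y - x).
Proof. by apply: eq_bigr => i _; rewrite !mxE -!expr2 -[LHS]sqrrN opprB. Qed.

Lemma is_otmap_otmap mu nu : has_otmap mu nu -> is_otmap mu nu (otmap mu nu).
Proof.
by move=> [T [oT _]]; rewrite /otmap; case: xgetP => [T' -> //|/(_ T)].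
Qed.

Lemma otmap_unique mu nu T : has_otmap mu nu -> is_otmap mu nu T ->
  {ae mu, forall x, T x = otmap mu nu x}.
Proof.
move=> h oT; have oM := is_otmap_otmap h.
case: h => [T0 [_ U]]; have := U _ oT; have := U _ oM.
by apply: filterS2 => x -> ->.
Qed.

Lemma is_pushforward_id mu : is_pushforward id mu mu.
Proof. by split=> //; exact: measurable_id. Qed.

Lemma is_otmap_coord_measurable mu nu T : is_otmap mu nu T ->
  coord_measurable (fun x => T x - x).
Proof.
move=> [[mT _] _]; apply: coord_measurableB; apply: coord_measurable_fun => //.
Qed.

(** The quadratic inequality with its defect made explicit: the last term measures how far [y] is
    from the point of the segment from [x] to [z] at time [s]. *)
Lemma sqnorm_interpolation (s : R) (x y z : E) :
  (1 - s) * sqnorm (y - x) + s * sqnorm (z - y) =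
  s * (1 - s) * sqnorm (z - x) + sqnorm (y - x - s *: (z - x)).
Proof.
rewrite /sqnorm /dotrV !mulr_sumr -!big_split/=; apply: eq_bigr => i _.
by rewrite !mxE; ring.
Qed.

(** Nonnegativity replaces integrability here, so the identity can be used before the integrals are
    known to be finite. *)
Lemma integral_sqnorm_comb mu (k l : R) (f g : E -> E) :
  0 <= k -> 0 <= l -> coord_measurable f -> coord_measurable g ->
  (\int[mu]_x (k * sqnorm (f x) + l * sqnorm (g x))%:E =
   k%:E * \int[mu]_x (sqnorm (f x))%:E + l%:E * \int[mu]_x (sqnorm (g x))%:E)%E.
Proof.
move=> k0 l0 mf mg; have mE (h : E -> E) : coord_measurable h ->
    measurable_fun setT (fun x => (sqnorm (h x))%:E).
  by move=> mh; apply/measurable_EFinP; exact: measurable_sqnorm.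
have ge0 (h : E -> E) x : setT x -> (0 <= (sqnorm (h x))%:E)%E.
  by rewrite lee_fin sqnorm_ge0.
rewrite -(ge0_integralZl_EFin _ measurableT (ge0 f) (mE _ mf) k0).
rewrite -(ge0_integralZl_EFin _ measurableT (ge0 g) (mE _ mg) l0).
rewrite -ge0_integralD//.
- by move=> x _; rewrite mule_ge0 ?lee_fin ?sqnorm_ge0.
- by apply: measurable_funeM; exact: mE.
- by move=> x _; rewrite mule_ge0 ?lee_fin ?sqnorm_ge0.
- by apply: measurable_funeM; exact: mE.
Qed.

(** Integrate [sqnorm_interpolation] at [x], [a x], [r (a x)]. The left side is [s (1 - s) W^2],
    while the composite costs at least [W^2]; hence the defect integrates to zero and the composite
    is optimal. *)
Lemma displacement_ae mu kap nu (s : R) a r :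
  0 < s < 1 -> has_otmap mu nu -> is_otmap mu kap a -> is_otmap kap nu r ->
  W2 mu kap = s * W2 mu nu -> W2 kap nu = (1 - s) * W2 mu nu ->
  {ae mu, forall x, a x - x = s *: (otmap mu nu x - x)}.
Proof.
move=> /andP[s0 s1] hmn oa or Wa Wr.
have ma := is_otmap_coord_measurable oa; have mr := is_otmap_coord_measurable or.
have pra : is_pushforward (r \o a) mu nu := is_pushforward_comp oa.1 or.1.
have mra : coord_measurable (fun x => r (a x) - a x).
  by move=> i; exact: (measurableT_comp (mr i) oa.1.1).
have mh : coord_measurable (fun x => r (a x) - x).
  apply: coord_measurableB; apply: coord_measurable_fun; first exact: pra.1.
  exact: measurable_id.
have me := coord_measurableB ma (coord_measurableZ s mh).
have If := oa.2; rewrite Wa in If.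
have Ig : (\int[mu]_x (sqnorm (r (a x) - a x))%:E =
    (((1 - s) * W2 mu nu) ^+ 2)%:E)%E.
  rewrite -Wr -or.2.
  rewrite (integral_is_pushforward (h := fun y => sqnorm (r y - y)) oa.1)//.
    exact: measurable_sqnorm.
  by move=> y; exact: sqnorm_ge0.
have Ih : ((W2 mu nu ^+ 2)%:E <= \int[mu]_x (sqnorm (r (a x) - x))%:E)%E.
  under eq_integral do rewrite sqnormBC.
  exact: W2_le_common_source (is_pushforward_id mu) pra.
have s0' := ltW s0; have s1' : 0 <= 1 - s by rewrite subr_ge0 ltW.
set W := W2 mu nu in Wa Wr If Ig Ih *.
have tot : (((1 - s) * (s * W) ^+ 2 + s * ((1 - s) * W) ^+ 2)%:E =
    (s * (1 - s))%:E * \int[mu]_x (sqnorm (r (a x) - x))%:E +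
    \int[mu]_x (sqnorm (a x - x - s *: (r (a x) - x)))%:E)%E.
  rewrite EFinD !(EFinM _ (_ ^+ 2)) -If -Ig -[X in (_ = _ + X)%E]mul1e.
  rewrite -!integral_sqnorm_comb ?mulr_ge0//.
  by apply: eq_integral => x _; rewrite mul1r sqnorm_interpolation.
have [Dfin Ihle] : (\int[mu]_x (sqnorm (a x - x - s *: (r (a x) - x)))%:E = 0 /\
    \int[mu]_x (sqnorm (r (a x) - x))%:E = (W ^+ 2)%:E)%E.
  have : (0 <= \int[mu]_x (sqnorm (a x - x - s *: (r (a x) - x)))%:E)%E.
    by apply: integral_ge0 => x _; rewrite lee_fin sqnorm_ge0.
  have ss : 0 < s * (1 - s) by rewrite mulr_gt0// subr_gt0.
  (* The left side of [tot] is finite, which excludes infinite values of either integral. *)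
  move: tot Ih; case: (integral _ _ _) => [A||]; case: (integral _ _ _) => [B||] //=.
  - rewrite !lee_fin => -[tot] WA B0.
    have WA' : s * (1 - s) * W ^+ 2 <= s * (1 - s) * A by rewrite ler_pM2l.
    have B0' : B = 0 by lra.
    split; first by rewrite B0'.
    by congr EFin; apply: (mulfI (lt0r_neq0 ss)); lra.
  - by rewrite gt0_muley.
  - by rewrite gt0_muley.
(* Optimality lets uniqueness identify the composite with [otmap mu nu] almost everywhere. *)
have oh : is_otmap mu nu (r \o a) by split.
have ae0 : {ae mu, forall x, a x - x - s *: (r (a x) - x) = 0}.
  have /(ae_eq_integral_abs mu measurableT) : measurable_fun setT
      (fun x => (sqnorm (a x - x - s *: (r (a x) - x)))%:E).
    by apply/measurable_EFinP; exact: measurable_sqnorm.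
  case=> + _; under eq_integral do rewrite gee0_abs ?lee_fin ?sqnorm_ge0//.
  move=> /(_ Dfin); apply: filterS => x /(_ I) /= [] /sqnorm_eq0.
  exact.
have := otmap_unique hmn oh; move: ae0; apply: filterS2 => x /= e0 <-.
by apply/eqP; rewrite -subr_eq0 e0.
Qed.
End displacement.

(** * Convexity and subgradients of the functional *)

Section functional.
Variables (R : realType) (d : nat) (F : P2 R d -> \bar R).
Local Notation E := 'rV[R]_d.
Implicit Types mu nu kap : P2 R d.
Hypothesis F_gtNy : forall nu, (-oo < F nu)%E.
Hypothesis F_otmap : forall nu1 nu2,
  (F nu1 < +oo)%E -> (F nu2 < +oo)%E -> has_otmap nu1 nu2.

Lemma functional_fineK mu : (F mu < +oo)%E -> (fine (F mu))%:E = F mu.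
Proof. by move=> Fmu; rewrite fineK// fin_numElt F_gtNy. Qed.

(** Convexity makes [F] finite at the geodesic point of time [s], so optimal maps to and from it
    exist; constant speed supplies the distances that [displacement_ae] asks for. *)
Lemma convex_interpolant mu nu (s : R) : geodesically_convex F ->
  (F mu < +oo)%E -> (F nu < +oo)%E -> 0 < s < 1 ->
  exists kap, [/\ (F kap < +oo)%E,
    fine (F kap) <= (1 - s) * fine (F mu) + s * fine (F nu),
    W2 mu kap = s * W2 mu nu &
    {ae mu, forall x, otmap mu kap x - x = s *: (otmap mu nu x - x)}].
Proof.
move=> Fcvx Fmu Fnu s01; have /andP[s0 s1] := s01.
have [lam [lam0 lam1 lamW] lamF] := Fcvx mu nu.
have s01' : 0 <= s <= 1 by rewrite !ltW.
have := lamF s s01'; rewrite -(functional_fineK Fmu) -(functional_fineK Fnu).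
rewrite -!EFinM -EFinD => Fle.
have Fkap := le_lt_trans Fle (ltry _).
have W1 : W2 mu (lam s) = s * W2 mu nu.
  by rewrite -{1}lam0 lamW ?lexx ?ler01// sub0r normrN gtr0_norm.
have W1' : W2 (lam s) nu = (1 - s) * W2 mu nu.
  by rewrite -{1}lam1 lamW ?lexx ?ler01// distrC gtr0_norm ?subr_gt0.
exists (lam s); split => //.
  by rewrite -lee_fin (functional_fineK Fkap).
apply: (displacement_ae s01) W1 W1'; first exact: F_otmap.
  exact/is_otmap_otmap/F_otmap.
exact/is_otmap_otmap/F_otmap.
Qed.

Lemma W2_otmap mu nu : has_otmap mu nu ->
  (\int[mu]_x (sqnorm (otmap mu nu x - x))%:E = (W2 mu nu ^+ 2)%:E)%E.
Proof. by move=> /is_otmap_otmap[]. Qed.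

Lemma integrable_otmap mu nu : has_otmap mu nu ->
  mu.-integrable setT (EFin \o (fun x => sqnorm (otmap mu nu x - x))).
Proof.
move=> h; apply: integrable_sqnorm; last by rewrite W2_otmap// ltry.
exact: (is_otmap_coord_measurable (is_otmap_otmap h)).
Qed.

Lemma integrable_dot_otmap mu nu xi : has_otmap mu nu -> in_L2 mu xi ->
  mu.-integrable setT (EFin \o (fun x => dotrV (xi x) (otmap mu nu x - x))).
Proof.
move=> h [mxi ixi]; apply: integrable_dotrV.
- exact: coord_measurable_fun.
- exact: (is_otmap_coord_measurable (is_otmap_otmap h)).
- by apply: integrable_sqnorm => //; exact: coord_measurable_fun.
- exact: integrable_otmap.
Qed.

Lemma dotrVZr (k : R) (x y : E) : dotrV x (k *: y) = k * dotrV x y.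
Proof.
by rewrite /dotrV mulr_sumr; apply: eq_bigr => i _; rewrite !mxE mulrCA.
Qed.

(* Along a geodesic every term of the Frechet inequality is of order at least
   [s], so the remainder disappears after dividing by [s]. *)
Lemma subdifferential_le mu nu xi : geodesically_convex F ->
  in_subdifferential F mu xi -> (F nu < +oo)%E ->
  \int[mu]_x dotrV (xi x) (otmap mu nu x - x) <= fine (F nu) - fine (F mu).
Proof.
move=> Fcvx [Fmu xiL2 sub] Fnu; set I := \int[mu]_x _; set W := W2 mu nu.
apply/ler_addgt0Pr => e e0.
have W0 : 0 <= W := W2_ge0 _ _.
have W10 : 0 < W + 1 by rewrite ltr_wpDl.
(* With this tolerance the remainder at distance [s * W] is at most [s * e]; adding 1 avoids
   dividing by zero when [W = 0]. *)
have [delta delta0 sube] := sub (e / (W + 1)) (divr_gt0 e0 W10).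
(* The first entry keeps [s] below 1, the second brings the interpolant within [delta] of [mu]. *)
pose s := Num.min 2^-1 (delta / (W + 1)).
have s0 : 0 < s by rewrite lt_min divr_gt0// invr_gt0 ltr0n.
have s1 : s < 1.
  by rewrite gt_min invf_lt1 ?ltr0n// ltr1n.
have sW : s * W < delta.
  rewrite (@lt_le_trans _ _ (s * (W + 1)))// ?ltr_pM2l ?ltrDl//.
  by rewrite -ler_pdivlMr// ge_min lexx orbT.
have [|kap [Fkap Fle Wkap aekap]] := convex_interpolant Fcvx Fmu Fnu (s := s).
  by rewrite s0.
have := sube kap Fkap; rewrite Wkap -/W => /(_ sW).
rewrite -(functional_fineK Fmu) -(functional_fineK Fkap) -EFinB lee_fin.
have -> : \int[mu]_x dotrV (xi x) (otmap mu kap x - x) = s * I.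
  rewrite -RintegralZl//; last by apply: integrable_dot_otmap => //; exact: F_otmap.
  congr fine; apply: ae_eq_integral => //.
  - apply: measurable_int; apply: integrable_dot_otmap => //; exact: F_otmap.
  - apply/measurable_EFinP/measurable_funM => //.
    apply/measurable_EFinP; apply: measurable_int.
    by apply: integrable_dot_otmap => //; exact: F_otmap.
  - by move: aekap; apply: filterS => x -> _; rewrite dotrVZr.
move=> h; rewrite -(ler_pM2l s0).
have : e / (W + 1) * (s * W) <= s * e.
  rewrite mulrCA ler_pM2l// mulrAC ler_pdivrMr// ler_pM2l// lerDl ler01//.
lra.
Qed.

Lemma Rintegral_EFin mu (f : E -> R) : mu.-integrable setT (EFin \o f) ->
  (\int[mu]_x (f x)%:E = (\int[mu]_x f x)%:E)%E.
Proof. by move=> fi; rewrite fineK//; exact: integrable_fin_num fi. Qed.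

Lemma sqnorm_euler_step (h : R) (x u y : E) :
  sqnorm (x - h *: u - y) =
  sqnorm (y - x) + (2 * h * dotrV u (y - x) + h ^+ 2 * sqnorm u).
Proof.
rewrite /sqnorm /dotrV !mulr_sumr -!big_split/=; apply: eq_bigr => i _.
by rewrite !mxE; ring.
Qed.

Lemma W2_euler_step mu mu' nu xi (h : R) : has_otmap mu nu -> in_L2 mu xi ->
  is_pushforward (fun x : E => x - h *: xi x) mu mu' ->
  W2 mu' nu ^+ 2 <= W2 mu nu ^+ 2 +
    (2 * h * (\int[mu]_x dotrV (xi x) (otmap mu nu x - x)) +
     h ^+ 2 * \int[mu]_x sqnorm (xi x)).
Proof.
move=> hmn xiL2 pmu'.
have it := integrable_otmap hmn; have id := integrable_dot_otmap hmn xiL2.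
have ix : mu.-integrable setT (EFin \o (fun x => sqnorm (xi x))).
  have := integrable_sqnorm (coord_measurable_fun xiL2.1) xiL2.2; exact.

have id' := integrableZl measurableT (2 * h) id.
have ix' := integrableZl measurableT (h ^+ 2) ix.
rewrite -lee_fin; apply: le_trans.
  exact: (W2_le_common_source pmu' (is_otmap_otmap hmn).1).
under eq_integral do rewrite sqnorm_euler_step !EFinD !EFinM.
rewrite integralD//=; last exact: integrableD.
rewrite integralD// !integralZl// W2_otmap// !Rintegral_EFin//.
Qed.

(** If [F nu < F mu], semicontinuity at [mu] with threshold [F nu] would give [F nu < F nu]. This
    replaces equality in [P2], whose elements may differ outside Borel sets. *)
Lemma le_of_W2_eq0 mu nu : lsc_functional F -> W2 mu nu = 0 -> (F mu <= F nu)%E.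
Proof.
move=> Flsc W0; rewrite leNgt; apply/negP => /Flsc[delta delta0].
by move=> /(_ nu); rewrite W0 ltxx => /(_ delta0).
Qed.

(** The averaging map agrees almost everywhere with the optimal map to the interpolant [kap], so
    [mu'] is at distance zero from [kap] and inherits its bound. *)
Lemma convex_average mu nu mu' (s : R) :
  lsc_functional F -> geodesically_convex F ->
  (F mu < +oo)%E -> (F nu < +oo)%E -> 0 < s < 1 ->
  is_pushforward (fun x : E => (1 - s) *: x + s *: otmap mu nu x) mu mu' ->
  (F mu' <= ((1 - s) * fine (F mu) + s * fine (F nu))%:E)%E.
Proof.
move=> Flsc Fcvx Fmu Fnu s01 pmu'.
have [kap [Fkap Fle _ aekap]] := convex_interpolant Fcvx Fmu Fnu s01.
have [pkap _] := is_otmap_otmap (F_otmap Fmu Fkap).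
apply: (@le_trans _ _ (F kap)); last by rewrite -(functional_fineK Fkap) lee_fin.
apply: le_of_W2_eq0 => //; apply/eqP; rewrite -sqrf_eq0 eq_le sqr_ge0 andbT.
rewrite -lee_fin; apply: le_trans (W2_le_common_source pmu' pkap) _.
have m0 := coord_measurableB (coord_measurable_fun pmu'.1)
  (coord_measurable_fun pkap.1).
rewrite (ae_eq_integral (cst 0%E)) ?integral_cst ?mul0e//.
  by apply/measurable_EFinP; exact: measurable_sqnorm.
move: aekap; apply: filterS => x ex _ /=; congr EFin.
rewrite -[RHS](@sqnorm0 R d); congr sqnorm.
have -> : otmap mu kap x = x + s *: (otmap mu nu x - x) by rewrite -ex addrC subrK.
by apply/rowP => i; rewrite !mxE; ring.
Qed.

End functional.

(** * Convergence estimate for the averaged iterates *)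

Section convergence.
Variables (R : realType) (d : nat) (F : P2 R d -> \bar R).
Local Notation E := 'rV[R]_d.
Variables (eta : R) (mu mubar : nat -> P2 R d) (xi : nat -> E -> E).
Hypothesis F_gtNy : forall nu, (-oo < F nu)%E.
Hypothesis F_lsc : lsc_functional F.
Hypothesis F_convex : geodesically_convex F.
Hypothesis F_otmap : forall nu1 nu2,
  (F nu1 < +oo)%E -> (F nu2 < +oo)%E -> has_otmap nu1 nu2.
Hypothesis eta_gt0 : 0 < eta.
Hypothesis mu_iter : forward_euler F (fun=> eta) mu xi.

Lemma forward_euler_fin t : (F (mu t) < +oo)%E.
Proof. by have [[[]]] := mu_iter t. Qed.

(** The squared distance at time [T] stays on the right so that the induction closes; it is
    discarded only in [forward_euler_bound]. *)
Lemma forward_euler_telescope nu T : (F nu < +oo)%E ->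
  2 * eta * (\sum_(t < T) fine (F (mu t)) - T%:R * fine (F nu)) <=
  W2 (mu 0) nu ^+ 2 - W2 (mu T) nu ^+ 2 +
  eta ^+ 2 * \sum_(t < T) \int[mu t]_x sqnorm (xi t x).
Proof.
move=> Fnu; elim: T => [|T IH].
  by rewrite !big_ord0 mul0r !subrr !mulr0 addr0.
rewrite !big_ord_recr/= -natr1.
have [[sub _] pT] := mu_iter T; have [FT xiL2 _] := sub.
have := W2_euler_step (F_otmap FT Fnu) xiL2 pT.
have := subdifferential_le F_gtNy F_otmap F_convex sub Fnu.
(* Scaled by [2 * eta], the subgradient inequality bounds the inner product term of the Euler
   step. *)
rewrite -(ler_pM2l (mulr_gt0 (ltr0n R 2) eta_gt0)).
move: IH; lra.
Qed.

(** The weights stay uniform because [(1 - 1/(t+1)) / t = 1/(t+1)]. *)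
Lemma average_iterates_le T : average_iterates mu mubar -> (1 <= T)%N ->
  (F (mubar T) <= (T%:R^-1 * \sum_(t < T) fine (F (mu t)))%:E)%E.
Proof.
move=> [mubar1 mubarS]; elim: T => // -[_ _|T IH _].
  rewrite mubar1 big_ord_recr big_ord0/= add0r invr1 mul1r.
  by rewrite functional_fineK// forward_euler_fin.
have {}IH := IH isT.
(* The inductive bound also yields the finiteness required for the next averaging step, from index
   [T.+1] to [T.+2]. *)
have Fbar := le_lt_trans IH (ltry _).
have T0 : (0 : R) < T.+2%:R by rewrite ltr0n.
have sT : 0 < (T.+2%:R^-1 : R) < 1 by rewrite invr_gt0 T0/= invf_lt1// ltr1n.
apply: le_trans.
  exact: (convex_average F_gtNy F_otmap F_lsc F_convex Fbar
    (forward_euler_fin _) sT (mubarS T.+1 isT)).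
rewrite lee_fin [in leRHS]big_ord_recr/= mulrDr lerD2r.
move: IH; rewrite -(functional_fineK F_gtNy Fbar) lee_fin.
have s0 : (0 : R) <= 1 - T.+2%:R^-1 by rewrite subr_ge0 ltW//; case/andP: sT.
move=> /(ler_wpM2l s0) /le_trans; apply; rewrite mulrA.
suff -> : (1 - T.+2%:R^-1 : R) * T.+1%:R^-1 = T.+2%:R^-1 by [].
have T1 : (T.+1%:R : R) != 0 by rewrite pnatr_eq0.
have T2 : (T.+2%:R : R) != 0 by rewrite pnatr_eq0.
apply: (mulIf T2); apply: (mulIf T1).
rewrite mulVf// mul1r -mulrA [T.+2%:R * _]mulrC mulrA divfK//.
by rewrite mulrBl mul1r mulVf// -natr1 addrK.
Qed.

Lemma forward_euler_bound nu T : average_iterates mu mubar -> (1 <= T)%N ->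
  (F (mubar T) - F nu <= (euler_bound T (W2 (mu 0) nu)
     (\sum_(t < T) \int[mu t]_x sqnorm (xi t x)) eta)%:E)%E.
Proof.
move=> avg T1; have := F_gtNy nu.
(* When [F nu = +oo] the left side is [-oo]. *)
case Fnu : (F nu) => [n||]// _; last by rewrite addeC leNye.
have Fn : (F nu < +oo)%E by rewrite Fnu ltry.
have := average_iterates_le avg T1.
have := forward_euler_telescope T Fn; rewrite Fnu/=.
set S := \sum_(t < T) Rintegral _ _ _; set f := \sum_(t < T) fine _.
set w := W2 _ _ => tel Fbar.
apply: le_trans (leeD2r _ Fbar) _; rewrite -EFinD lee_fin /euler_bound.
have T0 : (0 : R) < T%:R by rewrite ltr0n.
rewrite -(ler_pM2l T0) mulrDr !mulrA divff ?gt_eqF// !mul1r.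
have e2 : 0 < 2 * eta by rewrite mulr_gt0.
rewrite -(ler_pM2l e2) !mulrDr.
have -> : 2 * eta * (w ^+ 2 / (2 * eta)) = w ^+ 2 by rewrite mulrC divfK ?gt_eqF.
have := sqr_ge0 (W2 (mu T) nu); move: tel; lra.
Qed.

End convergence.

(** * Optimization of the step size *)

Lemma euler_bound_opt (R : realType) T (w S : R) : 0 < w -> 0 < S ->
  euler_bound T w S (w / Num.sqrt S) = T%:R^-1 * w * Num.sqrt S.
Proof.
move=> w0 S0; have r0 : 0 < Num.sqrt S by rewrite sqrtr_gt0.
rewrite /euler_bound -{3}(sqr_sqrtr (ltW S0)).
(* At this step size both terms in the bracket equal [w * Num.sqrt S / 2]. *)
move: T%:R^-1 => k; field.
by rewrite !gt_eqF.
Qed.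

Lemma euler_bound_min (R : realType) T (w S h : R) : 0 <= S -> 0 < h ->
  T%:R^-1 * w * Num.sqrt S <= euler_bound T w S h.
Proof.
move=> S0 h0; rewrite /euler_bound -mulrA ler_wpM2l ?invr_ge0//.
have e2 : 0 < 2 * h by rewrite mulr_gt0.
rewrite -(ler_pM2l e2) mulrDr [X in _ <= X + _]mulrC divfK ?gt_eqF//.
rewrite -[in leRHS](sqr_sqrtr S0).
(* After multiplication by [2 * h], the gap between the two sides is exactly this square. *)
have := sqr_ge0 (w - h * Num.sqrt S); lra.
Qed.

Unset Implicit Arguments.
Set Strict Implicit.

Theorem theorem42 (R : realType) (d : nat) (F : P2 R d -> \bar R)
    (eta : R) (mu mubar : nat -> P2 R d) (xi : nat -> 'rV[R]_d -> 'rV[R]_d)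
    (F_gtNy : forall nu, (-oo < F nu)%E)
    (F_proper : proper_functional F)
    (F_lsc : lsc_functional F)
    (F_convex : geodesically_convex F)
    (F_ac : forall nu, (F nu < +oo)%E -> absolutely_continuous nu)
    (F_otmap : forall nu1 nu2,
       (F nu1 < +oo)%E -> (F nu2 < +oo)%E -> has_otmap nu1 nu2)
    (eta_gt0 : 0 < eta)
    (mu_iter : forward_euler F (fun=> eta) mu xi)
    (mubar_avg : average_iterates mu mubar)
    (T : nat) (T_ge1 : (1 <= T)%N) (nu : P2 R d) :
  let w := W2 (mu 0%N) nu in
  let S := \sum_(t < T) \int[mu t]_x sqnorm (xi t x) in
  [/\ (F (mubar T) - F nu <= (euler_bound T w S eta)%:E)%E,
      (0 < w -> 0 < S ->
         0 < w / Num.sqrt S /\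
         forall h, 0 < h ->
           euler_bound T w S (w / Num.sqrt S) <= euler_bound T w S h) &
      (eta = w / Num.sqrt S ->
         (F (mubar T) - F nu <= (T%:R^-1 * w * Num.sqrt S)%:E)%E)].
Proof.
Proof.
move=> w S; have bound := forward_euler_bound F_gtNy F_lsc F_convex F_otmap
  eta_gt0 mu_iter nu mubar_avg T_ge1; split=> //.
  move=> w0 S0; split; first by apply: divr_gt0 w0 _; rewrite sqrtr_gt0.
  by move=> h h0; rewrite euler_bound_opt// euler_bound_min// ltW.
move=> etaE.
(* Positivity of [eta] forces [w] and [S] to be positive: since the inverse of 0 is 0, a zero root
   would make the quotient vanish. *)
have q0 : 0 < w / Num.sqrt S by rewrite -etaE.
have r0 : 0 < Num.sqrt S.
  rewrite lt0r sqrtr_ge0 andbT; apply: contraTneq q0 => ->.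
  by rewrite invr0 mulr0 ltxx.
have w0 : 0 < w by rewrite -(pmulr_lgt0 w (x := (Num.sqrt S)^-1)) ?invr_gt0.
have S0 : 0 < S by rewrite -sqrtr_gt0.
by rewrite -euler_bound_opt// -etaE.
Qed.
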